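(* Let $(X,d)$ be a finite dimensional metric space with Borel $\sigma$-algebra $\mathcal{A}$ and let $(X,\mathcal{A},\mu,T)$ be a measure preserving system. Assume that $(X,d)$ is tight, that the correlation dimension $C_\mu$ exists and is strictly positive, and that there exist a Banach space $\mathcal{C}$ of real-valued functions on $X$ with norm $\|\cdot\|_{\mathcal{C}}$ and constants $0\le a<1$, $0<r_0<1$, $c\ge0$, $\xi\ge0$ such that: (i) for all $\psi,\phi\in\mathcal{C}$ and all integers $n\ge1$, $$\left|\int_X\psi\cdot\phi\circ T^n\,d\mu-\int_X\psi\,d\mu\int_X\phi\,d\mu\right|\le\|\psi\|_{\mathcal{C}}\|\phi\|_{\mathcal{C}}\,a^n;$$ (ii) for every $0<r<r_0$, the function $\psi_1:x\mapsto\mu(B(x,r))$ belongs to $\mathcal{C}$ and $\|\psi_1\|_{\mathcal{C}}\le c\,r^{-\xi}$; (iii) for $\mu$-almost every $y\in X$ and every $0<r<r_0$, the function $\psi_2:x\mapsto\mathbf{1}_{B(y,r)}(x)$ belongs to $\mathcal{C}$ and $\|\psi_2\|_{\mathcal{C}}\le c\,r^{-\xi}$. Then for $\mu\otimes\mu$-almost every $(x,y)\in X\times X$, $$\lim_{n\to+\infty}\frac{\log m_n(x,y)}{-\log n}=\frac{2}{C_\mu}.$$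
   Context: A measure preserving system $(X,\mathcal{A},\mu,T)$ consists of a measurable map $T:X\to X$ and a probability measure $\mu$ on $(X,\mathcal{A})$ that is $T$-invariant: $\mu(T^{-1}A)=\mu(A)$ for all $A\in\mathcal{A}$. $B(x,r)$ denotes the open ball of center $x$ and radius $r$, and $\mathbf{1}_E$ the indicator function of $E$. The shortest distance between the orbits of $x$ and $y$ up to time $n$ is $$m_n(x,y)=\min_{i,j=0,\dots,n-1} d(T^ix,T^jy).$$ Convention: $\log 0=-\infty$, so that $\frac{\log m_n(x,y)}{-\log n}=+\infty$ if $m_n(x,y)=0$ (and $n\ge2$). The correlation dimension of $\mu$ is, when the limit exists, $$C_\mu=\lim_{r\to0}\frac{\log\int_X\mu(B(x,r))\,d\mu(x)}{\log r}.$$ A separable metric space $(X,d)$ is called tight if there exist $r_0>0$ and $N_0\in\mathbb{N}$ such that for any $0<r<r_0$ and any $x\in X$ one can cover $B(x,2r)$ by at most $N_0$ balls of radius $r$ (this $r_0$ is unrelated to the constant $r_0$ in the claim). *)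

(* Defs.v *)
From HB Require Import structures.
From mathcomp Require Import all_boot all_order all_algebra.
From mathcomp Require Import all_classical all_reals all_analysis.
Import Order.TTheory GRing.Theory Num.Theory.
Import numFieldTopology.Exports numFieldNormedType.Exports.

Set Implicit Arguments.
Unset Strict Implicit.
Unset Printing Implicit Defensive.

Local Open Scope classical_set_scope.
Local Open Scope ring_scope.

(* A measurable structure and a distance on the same carrier, with no
   compatibility assumed between them: see [borel_sigma_algebra]. A
   [measurableType] is pointed, which costs nothing here since a space that
   carries a probability measure is not empty. *)
#[short(type="measurableMetricType")]
HB.structure Definition MeasurableMetric (d : measure_display)
  (R : numDomainType) := {T of Measurable d T & Metric R T}.

Definition borel_sigma_algebra (d : measure_display) (R : realType)
    (X : measurableMetricType d R) : Prop :=
  @measurable d X = <<s @open X >>.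

Section metric_space.
Context {R : realType} {X : metricType R}.
Implicit Types (A U : set X) (s delta : R).
Local Open Scope ereal_scope.

(* 0 is adjoined so that the empty set has diameter 0. *)
Definition diameter U : \bar R :=
  ereal_sup (0 |` [set (mdist p.1 p.2)%:E | p in U `*` U]).

Definition hausdorff_premeasure s delta A : \bar R :=
  ereal_inf [set \sum_(0 <= i <oo) poweR (diameter (U i)) s |
    U in [set U : nat -> set X |
      A `<=` \bigcup_i U i /\ forall i, diameter (U i) <= delta%:E]].

Definition hausdorff_measure s A : \bar R :=
  ereal_sup [set hausdorff_premeasure s delta A |
    delta in [set delta | (0 < delta)%R]].

(* Restricting the infimum to s > 0 does not change the dimension, and avoids
   the convention needed for the diameter 0 raised to the power 0. *)
Definition hausdorff_dimension A : \bar R :=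
  ereal_inf [set s%:E | s in [set s | (0 < s)%R /\ hausdorff_measure s A = 0]].

End metric_space.

Definition finite_dimensional (R : realType) (X : metricType R) : Prop :=
  (hausdorff_dimension [set: X] < +oo)%E.

Definition separable (X : topologicalType) : Prop :=
  exists2 D : set X, countable D & dense D.

Definition tight (R : realType) (X : metricType R) : Prop :=
  separable X /\
  exists (r0 : R) (N0 : nat), 0 < r0 /\
    forall (r : R) (x : X), 0 < r < r0 ->
      exists2 s : seq X, (size s <= N0)%N &
        ball x (2 * r) `<=` \bigcup_(z in [set` s]) ball z r.

Definition measure_preserving (d : measure_display) (R : realType)
    (X : measurableType d) (mu : probability X R) (T : X -> X) : Prop :=
  measurable_fun setT T /\
  forall A : set X, measurable A -> mu (T @^-1` A) = mu A.

(* The logarithm is the extended one, with lne 0 = -oo. *)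
Definition has_correlation_dimension (d : measure_display) (R : realType)
    (X : measurableMetricType d R) (mu : probability X R) (Cmu : R) : Prop :=
  (lne (\int[mu]_x mu (ball x r)) / (ln r)%:E)%E @[r --> 0^'+] --> Cmu%:E.

(* For n >= 1 the term i = j = 0 is mdist x y, so the default value of the
   iterated minimum is neutral. *)
Definition shortest_orbit_distance (R : realType) (X : metricType R)
    (T : X -> X) (n : nat) (x y : X) : R :=
  \big[Num.min/mdist x y]_(i < n) \big[Num.min/mdist x y]_(j < n)
    mdist (iter i T x) (iter j T y).

(* [ev] presents the vector space C as a space of functions on X, its
   operations being pointwise; psi : C stands for the function [ev psi]. *)
Definition is_function_space (R : realType) (X : Type) (C : lmodType R)
    (ev : C -> X -> R) : Prop :=
  (forall x, scalar (ev ^~ x)) /\ injective ev.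

(* Integrals are total: the existence of those that occur in the inequality
   has to be stated. *)
Definition exponential_decay (d : measure_display) (R : realType)
    (X : measurableType d) (mu : probability X R) (T : X -> X)
    (C : normedModType R) (ev : C -> X -> R) (a : R) : Prop :=
  (forall psi : C, mu.-integrable setT (EFin \o ev psi)) /\
  forall (psi phi : C) (n : nat), (0 < n)%N ->
    mu.-integrable setT (fun x => (ev psi x * ev phi (iter n T x))%:E) /\
    `| \int[mu]_x (ev psi x * ev phi (iter n T x))
       - (\int[mu]_x ev psi x) * (\int[mu]_x ev phi x) |
      <= `|psi| * `|phi| * a ^+ n.

(* The function f lies in C, with norm at most b. *)
Definition in_with_norm_le (R : realType) (X : Type) (C : normedModType R)
    (ev : C -> X -> R) (f : X -> R) (b : R) : Prop :=
  exists2 psi : C, ev psi = f & `|psi| <= b.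

(* Main.v *)
Require Import Defs.
From HB Require Import structures.
From mathcomp Require Import all_boot all_order all_algebra.
From mathcomp Require Import all_classical all_reals all_analysis.
From mathcomp Require Import measurable_realfun lra ring zify.
Import Order.TTheory GRing.Theory Num.Theory.
Import numFieldTopology.Exports numFieldNormedType.Exports.

Local Open Scope classical_set_scope.
Local Open Scope ring_scope.

(** Write [M(r)] for the integral of [mu (ball x r)], so that [M(r)] is
    [r ^ (Cmu + o(1))]. Since [m_n] decreases with [n], it is enough to follow
    it along [n = 2 ^ k], and to compare it with [r = 2 ^ (- t k)] for [t] on
    either side of [2 / Cmu] ([cvg_log_ratio_of_dyadic]). On this scale every
    probability met below is geometric in [k] up to a power of [k], and
    Borel-Cantelli ([borel_cantelli_geometric]) makes the bounds almost sure.

    If [t > 2 / Cmu], invariance gives each event [d(T^i x, T^j y) < r] the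
    probability [M(r)]. The union bound [P(m_n < r) <= n^2 M(r)] is then
    geometrically small ([ae_eventually_ge]).

    If [t < 2 / Cmu], let [S] be the number of pairs [i, j < n] with
    [d(T^i x, T^j y) < r]. Its mean [n^2 M(r)] tends to infinity, and the second
    moment method ([second_moment_method]) bounds [P(S = 0)] by the relative
    variance of [S] ([measure_never_close_le]). The second moment is a sum over
    [i, j, i', j'] of probabilities of two simultaneous events; with a time gap
    [g] proportional to [k] and an error [e] of order [r ^ (- 2 xi) a ^ g]:
    - if [|i - i'| >= g] and [|j - j'| >= g], decay of correlations, used first
      for indicators of balls and then for [x |-> mu (ball x r)], decouples both
      coordinates and leaves [M(r)^2 + 2 e];
    - if only one gap is large, a single decoupling leaves the integral of a
      product of two masses of balls, plus [e];
    - if neither is, one event alone gives [M(r)].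

    In the middle case the integral is at most [M(r)] times the largest mass of
    a ball of radius [r]. Tightness bounds that mass by a constant times
    [sqrt (M(r))] ([ball_mass_le_sqrt_corr_integral]): some ball of radius
    [r / 2] carries a fixed fraction of it, and each point of that smaller ball
    has a neighbourhood of radius [r] which contains the whole of it. The few
    pairs of indices in the last two cases then contribute terms of order
    [g / (n sqrt (M(r)))] and [g^2 / (n^2 M(r))], which are summable over [k]
    because [n^2 M(r)] grows geometrically ([variance_bound_geometric]). *)

(** * Measure-theoretic tools *)

(** A geometric rate is imposed only eventually, which is all that a bound
    valid for small radii provides. *)
Lemma borel_cantelli_geometric (d : measure_display) (R : realType)
    (Y : measurableType d) (P : {measure set Y -> \bar R}) (F : nat -> set Y)
    (K rho : R) :
  (forall k, measurable (F k)) -> 0 <= K -> 0 <= rho < 1 ->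
  (\forall k \near \oo, (P (F k) <= (K * rho ^+ k)%:E)%E) ->
  \forall y \ae P, \forall k \near \oo, ~ F k y.
Proof.
move=> mF K0 /andP[rho0 rho1] [k0 _ FK].
pose G k := F (k + k0)%N.
have G0 : P (lim_sup_set G) = 0%E.
  apply: lim_sup_set_cvg0 => [k|]; first exact: mF.
  apply: (@le_lt_trans _ _ (K / (1 - rho))%:E); last exact: ltry.
  apply: lime_le; first exact: is_cvg_nneseries.
  apply: nearW => n.
  apply: (@le_trans _ _ (\sum_(0 <= i < n) K * rho ^+ i)%:E).
    rewrite -sumEFin; apply: lee_sum => i _.
    apply: (le_trans (FK _ _)) => /=; first exact: leq_addl.
    by rewrite lee_fin ler_wpM2l// exprD ler_piMr ?exprn_ge0// exprn_ile1// ltW.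
  rewrite lee_fin -mulr_sumr ler_wpM2l// -[_^-1]mul1r ler_pdivlMr ?subr_gt0// mulrC.
  by rewrite -opprB mulNr big_mkord -subrX1 opprB gerBl exprn_ge0.
exists (lim_sup_set G); split => //.
  apply: bigcap_measurableType => n _.
  by apply: bigcup_measurable => k _; exact: mF.
move=> y /= ny n _.
apply: contrapT => H; apply: ny; exists (n + k0)%N => // k /= nk Fk.
apply: H; exists (k - k0)%N => /=.
  by rewrite leq_subRL ?(leq_trans _ nk) ?leq_addl// addnC.
by rewrite /G subnK// (leq_trans _ nk)// leq_addl.
Qed.

Lemma measure_bigcup_seq_le (d : measure_display) (R : realType)
    (Y : measurableType d) (P : {measure set Y -> \bar R}) (I : choiceType)
    (s : seq I) (F : I -> set Y) :
  (forall i, measurable (F i)) ->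
  (P (\bigcup_(i in [set` s]) F i) <= \sum_(i <- s) P (F i))%E.
Proof.
move=> mF; rewrite bigcup_seq.
elim: s => [|i s IH]; first by rewrite !big_nil measure0.
rewrite !big_cons; apply: (le_trans (measureU2 _ _ _)) => //.
  by apply: bigsetU_measurable => j _.
by rewrite leeD2l.
Qed.

Lemma measure_bigcup_fin_le (d : measure_display) (R : realType)
    (Y : measurableType d) (P : {measure set Y -> \bar R}) (I : finType)
    (F : I -> set Y) :
  (forall i, measurable (F i)) -> (P (\bigcup_i F i) <= \sum_i P (F i))%E.
Proof.
have -> : [set: I] = [set` index_enum I].
  by apply/seteqP; split => i //= _; exact: mem_index_enum.
exact: measure_bigcup_seq_le.
Qed.

Lemma product_measure_swap (d1 d2 : measure_display) (R : realType)
    (Y1 : measurableType d1) (Y2 : measurableType d2)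
    (P1 : {sigma_finite_measure set Y1 -> \bar R})
    (P2 : {sigma_finite_measure set Y2 -> \bar R})
    (A : set (Y1 * Y2)) (B : set (Y2 * Y1)) :
  measurable A -> measurable B -> (forall x y, A (x, y) <-> B (y, x)) ->
  ((P1 \x P2) A = (P2 \x P1) B)%E.
Proof.
move=> mA mB AB.
have indA : measurable_fun setT (EFin \o (\1_A : Y1 * Y2 -> R)).
  exact/measurable_EFinP.
have indB : measurable_fun setT (EFin \o (\1_B : Y2 * Y1 -> R)).
  exact/measurable_EFinP.
have -> : ((P1 \x P2) A = \int[(P1 \x P2)%E]_z (EFin \o (\1_A : _ -> R)) z)%E.
  by rewrite integral_indic ?setIT.
have -> : ((P2 \x P1) B = \int[(P2 \x P1)%E]_z (EFin \o (\1_B : _ -> R)) z)%E.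
  by rewrite integral_indic ?setIT.
have ge0 (Y : Type) (D : set Y) z : (0 <= (EFin \o (\1_D : Y -> R)) z)%E.
  by rewrite lee_fin.
apply: etrans (fubini_tonelli2 _ indA (ge0 _ A)) _.
apply: etrans _ (esym (fubini_tonelli1 _ indB (ge0 _ B))).
apply: eq_integral => y _; apply: eq_integral => x _ /=.
rewrite !indicE; congr (_%:R%:E); congr nat_of_bool.
by apply/idP/idP; rewrite !inE => /AB.
Qed.

Lemma integral_cst_probability (d : measure_display) (R : realType)
    (Y : measurableType d) (P : probability Y R) (r : \bar R) :
  (\int[P]_y r = r)%E.
Proof.
have P1 := probability_setT P.
by rewrite (integral_cst P measurableT r) (P1 : (P : measure Y R) setT = 1%E) mule1.
Qed.

(** If the counting function [S] of the sets [A i] has mean [N], then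
    [(S - N)^2] is [N^2] where no [A i] occurs. Integrating
    [N^2 1_(S = 0) + 2 N S <= S^2 + N^2], with all terms nonnegative, yields
    Chebyshev's bound without any variance. *)
Lemma second_moment_method (d : measure_display) (R : realType)
    (Y : measurableType d) (P : probability Y R) (I : finType)
    (A : I -> set Y) (N : R) :
  (forall i, measurable (A i)) -> (\sum_i P (A i) = N%:E)%E ->
  ((N ^+ 2)%:E * P (\bigcap_i ~` A i) + (N ^+ 2)%:E <=
    \sum_i \sum_j P (A i `&` A j))%E.
Proof.
move=> mA sumA.
have N0 : 0 <= N by rewrite -lee_fin -sumA; apply: sume_ge0.
set B := \bigcap_i ~` A i.
have mB : measurable B.
  rewrite /B -setC_bigcup; apply: measurableC.
  by apply: fin_bigcup_measurable => // i _.
pose S y : \bar R := (\sum_i (\1_(A i) y)%:E)%E.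
pose S2 y : \bar R := (\sum_i \sum_j (\1_(A i `&` A j) y)%:E)%E.
have mind D : measurable D -> measurable_fun setT (EFin \o (\1_D : Y -> R)).
  by move=> mD; apply/measurable_EFinP.
have mS : measurable_fun setT S by apply: emeasurable_sum => i; exact: mind.
have mS2 : measurable_fun setT S2.
  apply: emeasurable_sum => i; apply: emeasurable_sum => j.
  by apply: mind; exact: measurableI.
have S0 y : (0 <= S y)%E by apply: sume_ge0 => i _; rewrite lee_fin.
have S20 y : (0 <= S2 y)%E.
  by apply: sume_ge0 => i _; apply: sume_ge0 => j _; rewrite lee_fin.
have intS : (\int[P]_y S y = N%:E)%E.
  rewrite -sumA ge0_integral_sum//; last by move=> i; exact: mind.
  by apply: eq_bigr => i _; rewrite integral_indic// setIT.
have intS2 : (\int[P]_y S2 y = \sum_i \sum_j P (A i `&` A j))%E.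
  rewrite ge0_integral_sum//; last 2 first.
  - move=> i; apply: emeasurable_sum => j.
    by apply: mind; exact: measurableI.
  - by move=> i y _; apply: sume_ge0 => j _; rewrite lee_fin.
  apply: eq_bigr => i _; rewrite ge0_integral_sum//; last first.
    by move=> j; apply: mind; exact: measurableI.
  by apply: eq_bigr => j _; rewrite integral_indic// ?setIT//; exact: measurableI.
have ptw y : ((N ^+ 2)%:E * (\1_B y)%:E + (2 * N)%:E * S y <=
    S2 y + (N ^+ 2)%:E)%E.
  pose s : R := \sum_i \1_(A i) y.
  have -> : S y = s%:E by rewrite /S sumEFin.
  have -> : S2 y = (s ^+ 2)%:E.
    rewrite /S2 expr2 /s mulr_suml -sumEFin; apply: eq_bigr => i _.
    rewrite mulr_sumr -sumEFin; apply: eq_bigr => j _.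
    by rewrite indicI.
  rewrite -!EFinM -!EFinD lee_fin indicE; case: (boolP (y \in B)) => yB.
    have -> : s = 0.
      rewrite /s big1// => i _; rewrite indicE memNset//.
      by move: yB; rewrite inE => /(_ i Logic.I).
    by rewrite /=; lra.
  by have := sqr_ge0 (N - s); rewrite /=; nra.
have : (\int[P]_y ((N ^+ 2)%:E * (\1_B y)%:E + (2 * N)%:E * S y) <=
    \int[P]_y (S2 y + (N ^+ 2)%:E))%E.
  apply: ge0_le_integral => //.
  - by move=> y _; rewrite adde_ge0// mule_ge0// lee_fin ?sqr_ge0 ?mulr_ge0.
  - apply: emeasurable_funD; apply: measurable_funeM; [exact: mind|exact: mS].
  - by apply: emeasurable_funD.
rewrite ge0_integralD//; last 4 first.
- by move=> y _; rewrite mule_ge0// lee_fin sqr_ge0.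
- by apply: measurable_funeM; exact: mind.
- by move=> y _; rewrite mule_ge0// lee_fin mulr_ge0.
- exact: measurable_funeM.
rewrite ge0_integralD//; last by move=> y _; rewrite lee_fin sqr_ge0.
rewrite !ge0_integralZl_EFin//; last 3 first.
- by rewrite mulr_ge0.
- exact: mind.
- exact: sqr_ge0.
rewrite integral_indic// setIT intS intS2 integral_cst_probability.
by rewrite -EFinM -mulrA -expr2 mulr_natl mulr2n EFinD addeA leeD2rE.
Qed.

(** * From powers of 2 to all times *)

(** For [2 ^ k <= n < 2 ^ (k + 1)], monotonicity traps [u n] between the values
    at both ends, and [ln n] varies only by [ln 2], which is negligible against
    [k]. The exponents [L (1 - 1 / (m + 2))] and [L (1 + 1 / (m + 2))] form a
    countable positive family, so that the hypotheses can hold for all of them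
    outside a single negligible set. *)
Lemma cvg_log_ratio_of_dyadic (R : realType) (u : nat -> R) (L : R) :
  0 < L ->
  {homo u : m n / (m <= n)%N >-> n <= m} ->
  (forall m : nat, \forall k \near \oo,
    u (2 ^ k)%N < (2 `^ (- (L * (1 - m.+2%:R^-1)))) ^+ k) ->
  (forall m : nat, \forall k \near \oo,
    (2 `^ (- (L * (1 + m.+2%:R^-1)))) ^+ k <= u (2 ^ k)%N) ->
  (lne (u n)%:E / (- ln n%:R)%:E)%E @[n --> \oo] --> L%:E.
Proof.
move=> L0 udec ulow uhigh.
have ln2 : 0 < ln (2 : R) by rewrite ln_gt0// ltr1n.
have b0 t k : 0 < (2 `^ t : R) ^+ k by rewrite exprn_gt0// powR_gt0.
have lnb t k : ln ((2 `^ t : R) ^+ k) = k%:R * t * ln 2.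
  by rewrite lnXn ?powR_gt0// ln_powR -mulrA mulr_natl.
pose kk n := trunc_log 2 n.
have kkoo : kk n @[n --> \oo] --> \oo.
  apply/cvgnyPge => A; exists (2 ^ A)%N => // n /= An.
  by rewrite /kk trunc_log_max.
have kkb n : (0 < n)%N ->
    (kk n)%:R * ln 2 <= ln (n%:R : R) <= (kk n).+1%:R * ln 2.
  move=> n0; have /andP[h1 h2] := @trunc_log_bounds 2 n isT n0.
  rewrite !mulr_natl -!lnXn// -!natrX !ler_ln ?posrE ?ltr0n ?expn_gt0//.
  by rewrite !ler_nat h1 ltnW.
(* Positivity makes the extended logarithm finite; it follows from the lower
   bounds along powers of 2 by monotonicity. *)
have upos : \forall n \near \oo, 0 < u n.
  have := uhigh 0 => -[k0 _ h]; exists 1%N => // n /= n0.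
  have /andP[_ h2] := @trunc_log_bounds 2 n isT n0.
  have nle : (n <= 2 ^ (maxn k0 (kk n).+1))%N.
    by apply: (leq_trans (ltnW h2)); rewrite leq_exp2l// leq_maxr.
  apply: (lt_le_trans _ (udec _ _ nle)).
  by apply: (lt_le_trans _ (h _ _)) => //=; rewrite leq_maxl.
have key : \forall n \near \oo,
  (lne (u n)%:E / (- ln n%:R)%:E)%E = (- ln (u n) / ln n%:R)%:E.
  near=> n.
  have un : 0 < u n by near: n.
  have n1 : (1 < n)%N by near: n; exists 2.
  rewrite lne_EFin// inver oppr_eq0 gt_eqF ?ln_gt0 ?ltr1n//.
  by rewrite -EFinM invrN mulrN mulNr.
apply/fine_cvgP; split; first by apply: filterS key => n ->.
apply/cvgrPdist_le => e e0.
(* With [D = L / (m + 2)] and [4 L <= k e], the losses [k D] and [L + D] sum up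
   to less than [k e]. *)
pose m := Num.truncn (4 * L / e).
have Dm : L * m.+2%:R^-1 <= e / 4.
  have := truncnS_gt (4 * L / e); rewrite -/m ltr_pdivrMr// => mL.
  by rewrite ler_pdivrMr ?ltr0n// -[m.+2%:R]natr1; nra.
set D := L * _ in Dm.
have D0 : 0 <= D by rewrite mulr_ge0 ?invr_ge0 ?ler0n// ltW.
have low : \forall n \near \oo,
    u (2 ^ kk n)%N < (2 `^ (- (L * (1 - m.+2%:R^-1)))) ^+ kk n.
  exact: (kkoo _ (ulow m)).
have high : \forall n \near \oo,
    (2 `^ (- (L * (1 + m.+2%:R^-1)))) ^+ (kk n).+1 <= u (2 ^ (kk n).+1)%N.
  have [k0 _ hk] := uhigh m; have /cvgnyPge/(_ k0) := kkoo.
  by apply: filterS => n k0n; apply: hk => /=; exact: leqW.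
near=> n.
have un : 0 < u n by near: n.
have n1 : (1 < n)%N by near: n; exists 2.
have n0 : (0 < n)%N by exact: ltnW.
rewrite /= (near key n)//= distrC.
set k := kk n.
have ln0 : 0 < ln (n%:R : R) by rewrite ln_gt0// ltr1n.
have /andP[h1 h2] := @trunc_log_bounds 2 n isT n0.
have /andP[l1 l2] := kkb n n0.
have kL : 4 * L / e <= k%:R.
  rewrite (le_trans (ltW (truncnS_gt _)))// -/m ler_nat /k.
  by near: n; apply: (cvgnyPge _).1.
rewrite ler_pdivrMr // in kL.
have y1 : k%:R * (L - D) * ln 2 <= - ln (u n).
  rewrite lerNr -mulNr -mulrN -[- (L - D)]/(- (L - D)) -lnb ler_ln ?posrE//.
  apply: (le_trans (udec _ _ h1)).
  have -> : L - D = L * (1 - m.+2%:R^-1) by rewrite mulrBr mulr1.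
  by rewrite /k ltW//; near: n; exact: low.
have y2 : - ln (u n) <= k.+1%:R * (L + D) * ln 2.
  rewrite lerNl -mulNr -mulrN -lnb ler_ln ?posrE//.
  apply: (le_trans _ (udec _ _ (ltnW h2))).
  have -> : L + D = L * (1 + m.+2%:R^-1) by rewrite mulrDr mulr1.
  by rewrite /k; near: n; exact: high.
have bnd : `|- ln (u n) / ln n%:R - L| * ln n%:R <= e * ln n%:R.
  rewrite -{2}(gtr0_norm ln0) -normrM mulrBl divfK ?gt_eqF// ler_norml.
  move: l1 l2 y1 y2; rewrite -/k -[k.+1%:R]natr1.
  have K0 : 0 <= k%:R :> R := ler0n _ _.
  move: (k%:R : R) K0 kL (ln (n%:R : R)) (ln (2 : R)) ln2.
  move=> K K0 kL l lam lam0 l1 l2 y1 y2.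
  have E1 : L * l <= L * ((K + 1) * lam) by rewrite ler_pM2l.
  have E2 : e * (K * lam) <= e * l by rewrite ler_pM2l.
  have E2' : L * (K * lam) <= L * l by rewrite ler_pM2l.
  have E3 : lam * (4 * L) <= lam * (K * e) by rewrite ler_pM2l.
  have E4 : K * lam * D <= K * lam * (e / 4) by rewrite ler_wpM2l// mulr_ge0// ltW.
  have E5 : lam * D <= lam * L.
    rewrite ler_pM2l// /D ler_piMr ?(ltW L0)// invf_le1 ?ltr0n//.
    by rewrite ler1n.
  apply/andP; split; nra.
by rewrite -(ler_pM2r ln0).
Unshelve. all: end_near.
Qed.

(** * Balls and the correlation integral *)

Section geometry.
Context {d : measure_display} {R : realType} {X : measurableMetricType d R}.
Hypothesis borelX : borel_sigma_algebra X.

Lemma open_mball (x : X) (r : R) : open (ball x r).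
Proof.
rewrite openE => y; rewrite ballEmdist /= => xy.
rewrite /interior -nbhs_ballE; exists (r - mdist x y) => /=; first by rewrite subr_gt0.
move=> z; rewrite !ballEmdist /= => yz.
by apply: (le_lt_trans (metric_triangle x y z)); rewrite -ltrBrDl.
Qed.

Lemma measurable_mball (x : X) (r : R) : measurable (ball x r).
Proof. by rewrite borelX; apply: sub_gen_smallest; exact: open_mball. Qed.

(** The Borel sets of a product may exceed the product sigma-algebra; in a
    separable space the open set of pairs at distance less than [r] is a
    countable union of rectangles. *)
Lemma measurable_near_pairs (r : R) : separable X ->
  measurable [set z : X * X | ball z.1 r z.2].
Proof.
move=> [D cD dD].
have -> : [set z : X * X | ball z.1 r z.2] =
    \bigcup_(q in D) \bigcup_n
      (ball q n.+1%:R^-1 `*` ball q (r - n.+1%:R^-1)).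
  apply/seteqP; split => [[x y]|[x y] [q Dq [n _] [/= qx qy]]] /=; last first.
    by have := ball_triangle (ball_sym qx) qy; rewrite addrC subrK.
  rewrite ballEmdist /= => xy.
  pose e := r - mdist x y.
  have e0 : 0 < e by rewrite subr_gt0.
  have [n _ /(_ n (leqnn n)) ne] :=
    near_infty_natSinv_lt (PosNum (divr_gt0 e0 (ltr0n _ 2))).
  rewrite /= in ne.
  have n0 : 0 < n.+1%:R^-1 :> R by rewrite invr_gt0.
  have [|q [xq Dq]] := dD (ball x n.+1%:R^-1) _ (open_mball _ _).
    by exists x; exact: ballxx.
  exists q => //; exists n => //; split => /=; first exact: ball_sym.
  move: xq ne; rewrite /e !ballEmdist /= => xq ne.
  apply: (le_lt_trans (metric_triangle q x y)); rewrite (metric_sym q x).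
  move: xq ne; move: (n.+1%:R^-1) => t; lra.
rewrite bigcup_set_type; apply: countable_bigcupT_measurable => [|q].
  by rewrite (eq_countable (card_setT _)).
apply: bigcup_measurable => n _.
by apply: measurableX; exact: measurable_mball.
Qed.

Lemma measurable_ball_mass (mu : probability X R) (r : R) : separable X ->
  measurable_fun [set: X] ((fun x => mu (ball x r)) : X -> \bar R).
Proof.
move=> sepX; have := measurable_fun_xsection mu (measurable_near_pairs r sepX).
apply: eq_measurable_fun => x _ /=; congr (mu _).
by apply/seteqP; split => y; rewrite /xsection /= inE.
Qed.

Definition corr_integral (mu : probability X R) (r : R) : R :=
  fine (\int[mu]_x mu (ball x r)).

Lemma corr_integralE (mu : probability X R) (r : R) : separable X ->
  (\int[mu]_x mu (ball x r))%E = (corr_integral mu r)%:E.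
Proof.
move=> sepX; rewrite fineK// ge0_fin_numE ?integral_ge0//.
apply: (@le_lt_trans _ _ (\int[mu]_x cst 1%E x)%E); last first.
  rewrite integral_cst// mul1e; apply: le_lt_trans (ltry 1).
  exact: probability_le1.
apply: ge0_le_integral => //; first exact: measurable_ball_mass.
by move=> x _; apply: probability_le1; exact: measurable_mball.
Qed.

Lemma corr_integral_ge0 (mu : probability X R) (r : R) : 0 <= corr_integral mu r.
Proof. by rewrite fine_ge0// integral_ge0. Qed.

Lemma ball_mass_fin_num (mu : probability X R) (x : X) (r : R) :
  mu (ball x r) \is a fin_num.
Proof. by apply: fin_num_measure; exact: measurable_mball. Qed.

(** Any [x] in [ball z (r / 2)] satisfies [ball z (r / 2) `<=` ball x r], so the
    correlation integral restricted to [ball z (r / 2)] is already at least the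
    square of its mass. *)
Lemma half_ball_mass_le (mu : probability X R) (r : R) (z : X) : separable X ->
  fine (mu (ball z (r / 2))) <= Num.sqrt (corr_integral mu r).
Proof.
move=> sepX; set g := fine _.
have g0 : 0 <= g by rewrite fine_ge0.
have r0 : 0 <= corr_integral mu r := corr_integral_ge0 mu r.
rewrite -(ler_pXn2r (ltn0Sn 1)) ?nnegrE ?sqrtr_ge0// sqr_sqrtr//.
rewrite -lee_fin -corr_integralE// expr2 EFinM.
have gE : g%:E = mu (ball z (r / 2)) by rewrite fineK// ball_mass_fin_num.
rewrite [X in (_ * X)%E]gE -integral_cst; last exact: measurable_mball.
apply: (@le_trans _ _ (\int[mu]_(x in ball z (r / 2)) mu (ball x r))%E).
  apply: ge0_le_integral => //; first exact: measurable_mball.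
    by apply: measurable_funTS; exact: measurable_ball_mass.
  move=> x zx /=; rewrite gE le_measure ?inE; [by []|exact: measurable_mball..|].
  move=> y zy; rewrite [r]splitr; apply: ball_triangle zy.
  exact: ball_sym.
apply: ge0_subset_integral => //; first exact: measurable_mball.
exact: measurable_ball_mass.
Qed.

(** A ball of radius [r] is covered by boundedly many balls of radius [r / 2],
    and the previous bound applies to each of these, whatever their centers. *)
Lemma ball_mass_le_sqrt_corr_integral (mu : probability X R) : tight X ->
  exists (r1 : R) (N : nat), 0 < r1 /\ forall r x, 0 < r < r1 ->
    fine (mu (ball x r)) <= N%:R * Num.sqrt (corr_integral mu r).
Proof.
move=> [sepX [r0 [N [r00 cov]]]].
exists (2 * r0), N; split; first by rewrite mulr_gt0.
move=> r x /andP[r_gt0 rr0].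
have [|s sN xs] := cov (r / 2) x; first by rewrite divr_gt0// ltr_pdivrMr// mulrC.
move: xs; rewrite mulrC divfK// => xs.
have : (mu (ball x r) <= \sum_(z <- s) mu (ball z (r / 2)))%E.
  have mz (z : X) : measurable (ball z (r / 2)) by exact: measurable_mball.
  apply: (le_trans _ (measure_bigcup_seq_le _ _ _ mu _ s _ mz)).
  apply: le_measure => //; rewrite inE; first exact: measurable_mball.
  by rewrite bigcup_seq; apply: bigsetU_measurable => z _; exact: mz.
rewrite -(fineK (ball_mass_fin_num mu x r)).
rewrite (eq_bigr (fun z => (fine (mu (ball z (r / 2))))%:E)); last first.
  by move=> z _; rewrite fineK// ball_mass_fin_num.
rewrite sumEFin lee_fin => /le_trans; apply.
apply: (@le_trans _ _ (\sum_(z <- s) Num.sqrt (corr_integral mu r))).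
  by apply: ler_sum => z _; exact: half_ball_mass_le.
rewrite big_const_seq count_predT iter_addr_0 -[leLHS]mulr_natl ler_wpM2r ?sqrtr_ge0//.
by rewrite ler_nat.
Qed.
End geometry.

Section correlation_dimension.
Context {d : measure_display} {R : realType} {X : measurableMetricType d R}.
Context {mu : probability X R} {Cmu : R}.
Hypothesis sepX : separable X.
Hypothesis borelX : borel_sigma_algebra X.
Hypothesis dimC : has_correlation_dimension mu Cmu.

Lemma corr_integral_power_bounds (lo hi : R) : lo < Cmu -> Cmu < hi ->
  exists2 r1 : R, 0 < r1 & forall r, 0 < r < r1 ->
    r `^ hi <= corr_integral mu r <= r `^ lo.
Proof.
move=> loC Chi.
have /fine_cvgP [finF cvF] := dimC.
have [e1 /= e10 He1] : \forall r \near (0 : R)^'+,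
    lo < fine (lne (\int[mu]_x mu (ball x r)) / (ln r)%:E)%E.
  exact: (cvgr_gt _ cvF).
have [e2 /= e20 He2] : \forall r \near (0 : R)^'+,
    fine (lne (\int[mu]_x mu (ball x r)) / (ln r)%:E)%E < hi.
  exact: (cvgr_lt _ cvF).
have [e3 /= e30 He3] := finF.
exists (Num.min 1 (Num.min e1 (Num.min e2 e3))).
  by rewrite !lt_min ltr01 e10 e20 e30.
move=> r /andP[r0]; rewrite !lt_min => /and4P[r1 re1 re2 re3].
have nr e : r < e -> `|0 - r| < e by rewrite sub0r normrN gtr0_norm.
have := He1 _ (nr _ re1) r0; have := He2 _ (nr _ re2) r0.
have := He3 _ (nr _ re3) r0.
rewrite corr_integralE//.
have lnr : ln r < 0 by rewrite ln_lt0// r0.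
rewrite inver lt_eqF//.
(* A vanishing integral would make the ratio infinite. *)
have [M0|M0] := ltP 0 (corr_integral mu r); last first.
  rewrite le0_lneNy ?lee_fin// lt0_mulNye//.
  by rewrite lte_fin invr_lt0.
rewrite lne_EFin// -EFinM /= => _ h1 h2.
rewrite ltr_ndivrMr// in h1; rewrite ltr_ndivlMr// in h2.
by rewrite -[corr_integral mu r]lnK ?posrE// /powR gt_eqF// !ler_expR !ltW.
Qed.

End correlation_dimension.

(** * Iterates of the map and decay of correlations *)

Section measure_preserving_iterates.
Context {d : measure_display} {R : realType} {X : measurableType d}.
Context {mu : probability X R} {T : X -> X}.
Hypothesis mpT : measure_preserving mu T.

Lemma measurable_iter n : measurable_fun setT (iter n T).
Proof.
have [mT _] := mpT.
by elim: n => [|n IH]; [exact: measurable_id|exact: measurableT_comp].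
Qed.

Lemma measurable_preimage_iter n A :
  measurable A -> measurable (iter n T @^-1` A).
Proof. by move=> mA; rewrite -[_ @^-1` _]setTI; exact: measurable_iter. Qed.

Lemma measure_preimage_iter n A : measurable A -> mu (iter n T @^-1` A) = mu A.
Proof.
have [_ muT] := mpT.
elim: n => // n IH mA.
rewrite -IH// -(muT _ (measurable_preimage_iter n _ mA)).
by congr (mu _); apply/funext => x; rewrite /preimage/= -iterSr.
Qed.

Lemma integral_iter n (f : X -> \bar R) : measurable_fun setT f ->
  (forall x, 0 <= f x)%E -> (\int[mu]_x f (iter n T x) = \int[mu]_x f x)%E.
Proof.
move=> mf f0.
have := @ge0_integral_pushforward _ _ _ _ _ _ (measurable_iter n) mu setT f
  measurableT mf (fun y _ => f0 y).
rewrite preimage_setT => <-.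
apply: eq_measure_integral => [|mphi A mA _]; first exact: measurable_iter.
by rewrite /= /pushforward measure_preimage_iter.
Qed.

Lemma ae_iter (Q : X -> Prop) : (\forall x \ae mu, Q x) ->
  \forall x \ae mu, forall n, Q (iter n T x).
Proof.
move=> [N [mN N0 QN]]; apply: ae_foralln => n.
exists (iter n T @^-1` N); split.
- exact: measurable_preimage_iter.
- exact: (etrans (measure_preimage_iter n _ mN) N0).
- by move=> x nQ; exact: QN.
Qed.

End measure_preserving_iterates.

(** Being far is symmetric in the two times, and its negation leaves at most
    [2 g] values of one time when the other is fixed. *)
Definition far (g i j : nat) := (i + g <= j)%N || (j + g <= i)%N.

Section decay.
Context {d : measure_display} {R : realType} {X : measurableType d}.
Context {mu : probability X R} {T : X -> X} {C : normedModType R}.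
Context {ev : C -> X -> R} {a : R}.
Hypothesis mpT : measure_preserving mu T.
Hypothesis decay : exponential_decay mu T ev a.
Hypothesis a01 : 0 <= a < 1.

Lemma integral_decay (f h : X -> R) (K : R) (n : nat) :
  in_with_norm_le ev f K -> in_with_norm_le ev h K -> (0 < n)%N ->
  (\int[mu]_x (f x * h (iter n T x))%:E <=
    ((\int[mu]_x f x)%R * (\int[mu]_x h x)%R + K ^+ 2 * a ^+ n)%:E)%E.
Proof.
move=> [psi <- psiK] [phi <- phiK] n0.
have [int dec] := decay.2 psi phi n n0.
rewrite -(fineK (integrable_fin_num _ int))// lee_fin -lerBlDl.
apply: (le_trans (ler_norm _)); apply: (le_trans dec).
have /andP[a0 _] := a01.
by rewrite ler_wpM2r ?exprn_ge0// expr2 ler_pM.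
Qed.

(** By invariance only the difference of the two times matters, and the rate
    [a ^+ n] decreases with it. *)
Lemma integral_decay_far (f h : X -> R) (K : R) (g i j : nat) :
  in_with_norm_le ev f K -> in_with_norm_le ev h K ->
  (forall x, 0 <= f x) -> (forall x, 0 <= h x) -> (0 < g)%N -> far g i j ->
  (\int[mu]_x (f (iter i T x) * h (iter j T x))%:E <=
    ((\int[mu]_x f x)%R * (\int[mu]_x h x)%R + K ^+ 2 * a ^+ g)%:E)%E.
Proof.
move=> fK hK f0 h0 g0 fij.
wlog ij : f h i j fK hK f0 h0 fij / (i + g <= j)%N => [wl|].
  case/orP: (fij) => ij; first exact: wl.
  under eq_integral do rewrite mulrC.
  by rewrite [X in (X + _)%:E]mulrC; apply: wl => //; rewrite /far ij.
have j_gt : (0 < j - i)%N by rewrite subn_gt0 (leq_trans _ ij)// -addn1 leq_add2l.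
have iterE x : iter j T x = iter (j - i) T (iter i T x).
  by rewrite -iterD subnK// (leq_trans _ ij)// leq_addr.
under eq_integral do rewrite iterE.
have [psi psiE _] := fK; have [phi phiE _] := hK.
have [int _] := decay.2 psi phi _ j_gt.
rewrite (integral_iter mpT i (fun x => (f x * h (iter (j - i) T x))%:E)); first last.
- by move=> x; rewrite lee_fin mulr_ge0.
- by move: int; rewrite psiE phiE; exact: measurable_int.
apply: (le_trans (integral_decay _ _ _ _ fK hK j_gt)).
rewrite lee_fin lerD2l ler_wpM2l ?sqr_ge0//.
have /andP[a0 a1] := a01.
by rewrite ler_wiXn2l ?(ltW a1)// leq_subRL// (leq_trans _ ij)// leq_addr.
Qed.
End decay.

(** * Sums over pairs of times *)

Lemma sum_near_le (R : realType) (n g : nat) :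
  \sum_(i < n) \sum_(j < n) (~~ far g i j)%:R <= n%:R * (2 * g%:R) :> R.
Proof.
apply: (@le_trans _ _ (\sum_(i < n) 2 * g%:R)); last first.
  by rewrite sumr_const card_ord -[leLHS]mulr_natl.
apply: ler_sum => i _.
rewrite -natr_sum -natrM ler_nat -(big_mkord predT (fun j => ~~ far g i j : nat)).
have -> : (\sum_(0 <= j < n) (~~ far g i j : nat) =
    size [seq j <- iota 0 n | ~~ far g i j])%N.
  rewrite size_filter -sum1_count [RHS]big_mkcond/= /index_iota subn0.
  by apply: eq_bigr => j _; case: far.
rewrite -[leqRHS](size_iota (i - g)); apply: uniq_leq_size.
  by rewrite filter_uniq// iota_uniq.
by move=> j; rewrite mem_filter !mem_iota /far; lia.
Qed.

Lemma sum_pairs (R : realType) (n : nat) (F : nat -> nat -> R) :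
  \sum_(p : 'I_n * 'I_n) F p.1 p.2 = \sum_(i < n) \sum_(j < n) F i j.
Proof. by rewrite pair_bigA. Qed.

Lemma sum_pairs_bilinear (R : realType) (n : nat) (x y : nat -> R) (c s m : R) :
  \sum_(p : 'I_n * 'I_n) (c + s * x p.1 + s * y p.2 + m * (x p.1 * y p.2)) =
  n%:R ^+ 2 * c + n%:R * s * (\sum_(i < n) x i) + n%:R * s * (\sum_(i < n) y i)
    + m * ((\sum_(i < n) x i) * (\sum_(i < n) y i)).
Proof.
have cst (u : R) : \sum_(i < n) u = n%:R * u.
  by rewrite sumr_const card_ord -[LHS]mulr_natl.
rewrite (sum_pairs R n (fun i j => c + s * x i + s * y j + m * (x i * y j))).
have inner (i : 'I_n) : \sum_(j < n) (c + s * x i + s * y j + m * (x i * y j)) =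
    n%:R * c + s * (\sum_(j < n) y j) + (n%:R * s + m * (\sum_(j < n) y j)) * x i.
  by rewrite !big_split/= !cst -!mulr_sumr; ring.
under eq_bigr do rewrite inner.
by rewrite !big_split/= !cst -!mulr_sumr; ring.
Qed.

Lemma sum_quadruples_bilinear (R : realType) (n : nat)
    (nearby : nat -> nat -> R) (c s m : R) :
  let V := \sum_(i < n) \sum_(j < n) nearby i j in
  \sum_(p : 'I_n * 'I_n) \sum_(q : 'I_n * 'I_n)
    (c + s * nearby p.1 q.1 + s * nearby p.2 q.2
      + m * (nearby p.1 q.1 * nearby p.2 q.2))
  = n%:R ^+ 4 * c + 2 * (n%:R ^+ 2 * s * V) + m * V ^+ 2.
Proof.
move=> V.
under eq_bigr do rewrite (sum_pairs_bilinear _ _ (nearby _) (nearby _)).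
rewrite (sum_pairs_bilinear R n (fun i => \sum_(j < n) nearby i j)
  (fun i => \sum_(j < n) nearby i j) (n%:R ^+ 2 * c) (n%:R * s) m) -/V.
by ring.
Qed.

(** * Pairs of close points on two orbits *)

Section pair_events.
Context {d : measure_display} {R : realType} {X : measurableMetricType d R}.
Context {mu : probability X R} {T : X -> X}.
Hypothesis borelX : borel_sigma_algebra X.
Hypothesis sepX : separable X.
Hypothesis mpT : measure_preserving mu T.
Variable r : R.

Definition close_at i j : set (X * X) :=
  [set z | ball (iter i T z.1) r (iter j T z.2)].

Lemma measurable_close_at i j : measurable (close_at i j).
Proof.
have mf : measurable_fun setT (fun z : X * X => (iter i T z.1, iter j T z.2)).
  apply: measurable_fun_pair.
    exact: (measurableT_comp (measurable_iter mpT i) measurable_fst).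
  exact: (measurableT_comp (measurable_iter mpT j) measurable_snd).
have := mf measurableT _ (measurable_near_pairs borelX r sepX).
by rewrite setTI.
Qed.

Lemma product_measureE (A : set (X * X)) :
  ((mu \x mu) A = \int[mu]_x mu (xsection A x))%E.
Proof. by []. Qed.

Lemma xsection_close_at i j x :
  xsection (close_at i j) x = iter j T @^-1` ball (iter i T x) r.
Proof. by apply/seteqP; split => y; rewrite /xsection /= inE. Qed.

(** Exchanging the roles of [x] and [y] exchanges the two pairs of times: it
    halves the case analysis on which of them are far apart. *)
Lemma close_atI_sym i j i' j' :
  ((mu \x mu) (close_at i j `&` close_at i' j') =
   (mu \x mu) (close_at j i `&` close_at j' i'))%E.
Proof.
apply: product_measure_swap => [||x y].
- by apply: measurableI; exact: measurable_close_at.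
- by apply: measurableI; exact: measurable_close_at.
by rewrite /close_at /=; split=> -[? ?]; split; exact: ball_sym.
Qed.

Lemma measurable_ball_mass_iter n :
  measurable_fun setT ((fun x => mu (ball (iter n T x) r)) : X -> \bar R).
Proof.
exact: (measurableT_comp (measurable_ball_mass borelX mu r sepX)
  (measurable_iter mpT n)).
Qed.

Lemma integral_ball_mass_iter i :
  (\int[mu]_x mu (ball (iter i T x) r) = (corr_integral mu r)%:E)%E.
Proof.
rewrite -corr_integralE//.
apply: (integral_iter mpT i (fun x => mu (ball x r))) => //.
exact: measurable_ball_mass.
Qed.

Lemma measure_close_at i j :
  ((mu \x mu) (close_at i j) = (corr_integral mu r)%:E)%E.
Proof.
rewrite product_measureE -(integral_ball_mass_iter i).
apply: eq_integral => x _; rewrite xsection_close_at.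
by apply: measure_preimage_iter => //; exact: measurable_mball.
Qed.

Context {C : normedModType R} {ev : C -> X -> R} {a K : R}.
Hypothesis decay : exponential_decay mu T ev a.
Hypothesis a01 : 0 <= a < 1.
Hypothesis massK : in_with_norm_le ev (fun x => fine (mu (ball x r))) K.
Hypothesis ballK : \forall y \ae mu, in_with_norm_le ev (\1_(ball y r)) K.
Variable g : nat.
Hypothesis g_gt0 : (0 < g)%N.

Let M := corr_integral mu r.
Let e := K ^+ 2 * a ^+ g.

Let e_ge0 : 0 <= e.
Proof. by rewrite mulr_ge0 ?sqr_ge0// exprn_ge0//; case/andP: a01. Qed.

(** First decoupling: the points [u] and [v] are frozen. *)
Lemma measure_preimage_ball_far (u v : X) (j j' : nat) :
  in_with_norm_le ev (\1_(ball u r)) K -> in_with_norm_le ev (\1_(ball v r)) K ->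
  far g j j' ->
  (mu (iter j T @^-1` ball u r `&` iter j' T @^-1` ball v r) <=
    mu (ball u r) * mu (ball v r) + e%:E)%E.
Proof.
move=> uK vK jj'.
have mp n w : measurable (iter n T @^-1` ball w r).
  by apply: (measurable_preimage_iter mpT); exact: measurable_mball.
have := integral_decay_far mpT decay a01 _ _ _ _ _ _ uK vK
  (fun=> ler0n _ _) (fun=> ler0n _ _) g_gt0 jj'.
have intB w : (\int[mu]_x \1_(ball w r) x)%R%:E = mu (ball w r).
  have mw : measurable (ball w r) by exact: (measurable_mball borelX).
  by rewrite /Rintegral integral_indic// setIT fineK// ball_mass_fin_num.
rewrite EFinD EFinM !intB; apply: le_trans.
rewrite -[X in mu X]setIT -integral_indic//; last exact: measurableI.
rewrite le_eqVlt; apply/orP; left; apply/eqP.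
by apply: eq_integral => x _; rewrite indicI.
Qed.

Lemma measure_closeI_le i j i' j' :
  ((mu \x mu) (close_at i j `&` close_at i' j') <= M%:E)%E.
Proof.
rewrite -(measure_close_at i j) le_measure// ?inE.
- by apply: measurableI; exact: measurable_close_at.
- exact: measurable_close_at.
Qed.

(** Integrating over the first point: almost every orbit consists of centers of
    balls whose indicators lie in the function space, by invariance. *)
Lemma measure_closeI_far i j i' j' : far g j j' ->
  ((mu \x mu) (close_at i j `&` close_at i' j') <=
   \int[mu]_x (mu (ball (iter i T x) r) * mu (ball (iter i' T x) r)) + e%:E)%E.
Proof.
move=> jj'.
have mG := measurable_ball_mass_iter.
rewrite -[e%:E](integral_cst_probability _ _ _ mu) -ge0_integralD//; last 2 first.
- by move=> x _; rewrite mule_ge0.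
- exact: emeasurable_funM.
have mI := measurableI _ _ (measurable_close_at i j) (measurable_close_at i' j').
rewrite product_measureE; apply: ae_ge0_le_integral => //.
- exact: measurable_fun_xsection.
- by move=> x _; rewrite adde_ge0// mule_ge0.
- by apply: emeasurable_funD => //; exact: emeasurable_funM.
have := ae_iter mpT _ ballK; apply: filterS => x good _.
rewrite xsectionI !xsection_close_at; exact: measure_preimage_ball_far.
Qed.

(** Second decoupling, now for the mass of balls as a function of the center. *)
Lemma integral_ball_massM_far i i' : far g i i' ->
  (\int[mu]_x (mu (ball (iter i T x) r) * mu (ball (iter i' T x) r)) <=
    (M ^+ 2 + e)%:E)%E.
Proof.
move=> ii'.
have := integral_decay_far mpT decay a01 _ _ _ _ _ _ massK massK
  (fun=> fine_ge0 (measure_ge0 _ _)) (fun=> fine_ge0 (measure_ge0 _ _)) g_gt0 ii'.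
have -> : (\int[mu]_x fine (mu (ball x r)))%R = M.
  congr fine; apply: eq_integral => x _.
  by rewrite fineK// ball_mass_fin_num.
rewrite expr2; apply: le_trans; rewrite le_eqVlt; apply/orP; left; apply/eqP.
by apply: eq_integral => x _; rewrite EFinM !fineK// ball_mass_fin_num.
Qed.

Variable smax : R.
Hypothesis mass_le : forall x, fine (mu (ball x r)) <= smax.

Let smax_ge0 : 0 <= smax.
Proof. by apply: le_trans (mass_le point); rewrite fine_ge0. Qed.

Lemma integral_ball_massM_le i i' :
  (\int[mu]_x (mu (ball (iter i T x) r) * mu (ball (iter i' T x) r)) <=
    (smax * M)%:E)%E.
Proof.
have mG := measurable_ball_mass_iter.
rewrite EFinM -(integral_ball_mass_iter i') -ge0_integralZl_EFin//.
apply: ge0_le_integral => //.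
- by move=> x _; rewrite mule_ge0.
- exact: emeasurable_funM.
- exact: measurable_funeM.
move=> x _; rewrite lee_wpmul2r//.
by rewrite -(fineK (ball_mass_fin_num borelX mu _ r)) lee_fin.
Qed.

(** The four cases, according to which pairs of times are far apart, are merged
    into one expression that is easy to sum: each 0-1 factor switches on the
    extra term of its case. *)
Lemma measure_closeI_bound i j i' j' :
  ((mu \x mu) (close_at i j `&` close_at i' j') <=
   (M ^+ 2 + 2 * e + smax * M * (~~ far g i i')%:R + smax * M * (~~ far g j j')%:R
     + M * ((~~ far g i i')%:R * (~~ far g j j')%:R))%:E)%E.
Proof.
have M0 : 0 <= M by exact: corr_integral_ge0.
have SM0 : 0 <= smax * M by exact: mulr_ge0.
have M20 : 0 <= M ^+ 2 by exact: sqr_ge0.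
have [ii'|ii'] := boolP (far g i i'); have [jj'|jj'] := boolP (far g j j');
  rewrite [X in (_ <= X)%E]/= ?mulr1 ?mulr0 ?addr0.
- apply: (le_trans (measure_closeI_far _ _ _ _ jj')).
  rewrite (_ : 2 * e = e + e); last by rewrite mulr2n mulrDl mul1r.
  by rewrite addrA EFinD leeD2r// integral_ball_massM_far.
- rewrite close_atI_sym; apply: (le_trans (measure_closeI_far _ _ _ _ ii')).
  rewrite (_ : _ + _ = smax * M + e + (M ^+ 2 + e)); last by ring.
  apply: (@le_trans _ _ (smax * M + e)%:E); last by rewrite lee_fin lerDl addr_ge0.
  by rewrite EFinD leeD2r// integral_ball_massM_le.
- apply: (le_trans (measure_closeI_far _ _ _ _ jj')).
  rewrite (_ : _ + _ = smax * M + e + (M ^+ 2 + e)); last by ring.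
  apply: (@le_trans _ _ (smax * M + e)%:E); last by rewrite lee_fin lerDl addr_ge0.
  by rewrite EFinD leeD2r// integral_ball_massM_le.
- apply: (le_trans (measure_closeI_le _ _ _ _)); rewrite lee_fin lerDr.
  by rewrite !addr_ge0// mulr_ge0.
Qed.

(** The three terms come from the mixing error, from the pairs of events with a
    small gap in at least one coordinate and from those with two small gaps; the
    main term [n ^ 4 M ^ 2] cancels against the square of the mean. *)
Lemma measure_never_close_le n : (0 < n)%N -> 0 < M ->
  ((mu \x mu) (\bigcap_(p : 'I_n * 'I_n) ~` close_at p.1 p.2) <=
    (2 * e / M ^+ 2 + 4 * g%:R * smax / (n%:R * M)
      + 4 * g%:R ^+ 2 / (n%:R ^+ 2 * M))%:E)%E.
Proof.
move=> n_gt0 M_gt0.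
set B := \bigcap_p _.
pose nearby i j : R := (~~ far g i j)%:R.
pose V := \sum_(i < n) \sum_(j < n) nearby i j.
have V0 : 0 <= V by apply: sumr_ge0 => i _; apply: sumr_ge0 => j _; exact: ler0n.
have Vle : V <= n%:R * (2 * g%:R) := sum_near_le R n g.
have sumN : (\sum_(p : 'I_n * 'I_n) (mu \x mu) (close_at p.1 p.2) =
    (n%:R ^+ 2 * M)%:E)%E.
  under eq_bigr do rewrite measure_close_at.
  rewrite sumEFin sumr_const card_prod card_ord -[X in X%:E]mulr_natl natrM.
  by rewrite expr2.
have mB : measurable B.
  apply: fin_bigcap_measurable => // p _; apply: measurableC.
  exact: measurable_close_at.
have SM : (((n%:R ^+ 2 * M) ^+ 2)%:E * (mu \x mu)%E B + ((n%:R ^+ 2 * M) ^+ 2)%:E <=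
    \sum_(p : 'I_n * 'I_n) \sum_(q : 'I_n * 'I_n)
      (mu \x mu)%E (close_at p.1 p.2 `&` close_at q.1 q.2))%E.
  exact: (second_moment_method _ _ _ (mu \x mu)%E _
    (fun p : 'I_n * 'I_n => close_at p.1 p.2)
  _ (fun p => measurable_close_at p.1 p.2) sumN).
have finB : (mu \x mu)%E B \is a fin_num.
  by rewrite ge0_fin_numE//; apply: le_lt_trans (ltry 1); exact: probability_le1.
have le2 : (\sum_(p : 'I_n * 'I_n) \sum_(q : 'I_n * 'I_n)
    (mu \x mu)%E (close_at p.1 p.2 `&` close_at q.1 q.2) <=
    (n%:R ^+ 4 * (M ^+ 2 + 2 * e) + 2 * (n%:R ^+ 2 * (smax * M) * V)
      + M * V ^+ 2)%:E)%E.
  rewrite -sum_quadruples_bilinear -sumEFin; apply: lee_sum => p _.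
  rewrite -sumEFin; apply: lee_sum => q _; exact: measure_closeI_bound.
move: (le_trans SM le2).
rewrite -(fineK finB) -!EFinM -!EFinD !lee_fin.
move: (fine _) => P hP.
have n0 : 0 < n%:R :> R by rewrite ltr0n.
have nM : 0 < n%:R ^+ 4 * M ^+ 2 by rewrite mulr_gt0 ?exprn_gt0.
rewrite -(ler_pM2r nM).
have -> : (2 * e / M ^+ 2 + 4 * g%:R * smax / (n%:R * M)
     + 4 * g%:R ^+ 2 / (n%:R ^+ 2 * M))
   * (n%:R ^+ 4 * M ^+ 2) =
   n%:R ^+ 4 * (2 * e) + 2 * (n%:R ^+ 2 * (smax * M) * (n%:R * (2 * g%:R)))
   + M * (n%:R * (2 * g%:R)) ^+ 2.
  by field; rewrite ?gt_eqF.
have h1 : n%:R ^+ 2 * (smax * M) * V <=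
    n%:R ^+ 2 * (smax * M) * (n%:R * (2 * g%:R)).
  by rewrite ler_wpM2l// mulr_ge0 ?exprn_ge0 ?mulr_ge0// ltW.
have h2 : M * V ^+ 2 <= M * (n%:R * (2 * g%:R)) ^+ 2.
  by rewrite ler_pM2l// ler_pXn2r ?nnegrE// (le_trans V0).
have : n%:R ^+ 4 = (n%:R ^+ 2) ^+ 2 :> R by rewrite -exprM.
by move: hP; rewrite exprMn => hP E4; rewrite E4 in hP *; nra.
Qed.

End pair_events.

(** * Geometric bounds along powers of 2 *)

(** Here [m] stands for the correlation integral at radius [2 ^ (- t k)], the
    gap is [q k], and [q] is chosen so large that the mixing error [a ^ (q k)]
    beats the losses [gam ^ k] and [beta ^ (- 2 k)]. The factors [k]
    that the gap introduces are absorbed by taking a square root [eta] of the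
    ratio [th], which is less than 1 exactly because [4 beta > 1]. *)
Lemma variance_bound_geometric (R : realType) (a beta gam c N : R) :
  0 <= a < 1 -> 0 < beta -> 1 < 4 * beta -> 0 <= gam -> 0 <= N ->
  exists (q : nat) (L rho : R), [/\ (0 < q)%N, 0 <= L, 0 <= rho < 1 &
    forall (k : nat) (m : R), beta ^+ k <= m ->
    2 * (c ^+ 2 * gam ^+ k * a ^+ (q * k)) / m ^+ 2
      + 4 * (q * k)%:R * (N * Num.sqrt m) / ((2 ^ k)%:R * m)
      + 4 * (q * k)%:R ^+ 2 / ((2 ^ k)%:R ^+ 2 * m) <= L * rho ^+ k].
Proof.
move=> /andP[a0 a1] b0 b1 g0 N0.
have aq0 : gam / beta ^+ 2 * a ^+ n @[n --> \oo] --> (0 : R).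
  rewrite -[X in _ --> X](mulr0 (gam / beta ^+ 2)); apply: cvgMr.
  by apply: cvg_expr; rewrite ger0_norm.
have [q0 _ hq] : \forall n \near \oo, gam / beta ^+ 2 * a ^+ n < 2^-1.
  by apply: (cvgr_lt _ aq0); rewrite invr_gt0.
pose q := q0.+1.
have qle : gam / beta ^+ 2 * a ^+ q < 2^-1 by apply: hq => /=; exact: leqnSn.
pose th := (2 * Num.sqrt beta)^-1.
pose eta := Num.sqrt th.
have sb0 : 0 < Num.sqrt beta by rewrite sqrtr_gt0.
have sb2 : Num.sqrt beta ^+ 2 = beta by rewrite sqr_sqrtr// ltW.
have th0 : 0 < th by rewrite invr_gt0 mulr_gt0.
have th1 : th < 1.
  rewrite invf_lt1 ?mulr_gt0// -(ltr_pXn2r (ltn0Sn 1)) ?nnegrE ?mulr_ge0// ?ltW//.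
  by rewrite expr1n exprMn sb2 -natrX.
have eta0 : 0 < eta by rewrite sqrtr_gt0.
have eta2 : eta ^+ 2 = th by rewrite sqr_sqrtr// ltW.
have eta1 : eta < 1.
  by rewrite -(ltr_pXn2r (ltn0Sn 1)) ?nnegrE ?(ltW eta0)// eta2 expr1n.
pose D := eta / (1 - eta).
have D0 : 0 <= D by rewrite divr_ge0 ?subr_ge0// ltW.
(* The sequence [k * eta ^ k] is bounded, by Bernoulli's inequality for
   [(1 / eta) ^ k]. *)
have kD k : k%:R * th ^+ k <= D * eta ^+ k.
  rewrite -eta2 -exprM mul2n -addnn exprD mulrA ler_pM2r ?exprn_gt0//.
  have h : 1 + k%:R * (eta^-1 - 1) <= eta^-1 ^+ k.
    have x0 : 0 <= eta^-1 - 1 by rewrite subr_ge0 invf_ge1 ?ltW.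
    rewrite -[in leRHS](subrK 1 eta^-1); move: (eta^-1 - 1) x0 => x x0.
    elim: k => [|k IH]; first by rewrite mul0r addr0 expr0.
    rewrite exprS -natr1; have : 0 <= k%:R * x ^+ 2 by rewrite mulr_ge0 ?sqr_ge0.
    have : (x + 1) * (1 + k%:R * x) <= (x + 1) * (x + 1) ^+ k.
      by rewrite ler_wpM2l// addr_ge0.
    nra.
  have ek : eta ^+ k * eta^-1 ^+ k = 1 by rewrite -exprMn divff ?gt_eqF// expr1n.
  have ek0 : 0 < eta ^+ k by rewrite exprn_gt0.
  have kge : 0 <= k%:R :> R := ler0n _ _.
  have h2 : k%:R * eta ^+ k * (eta^-1 - 1) <= 1.
    rewrite -[leRHS]ek mulrAC mulrC ler_pM2l//.
    by apply: le_trans h; rewrite lerDr.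
  rewrite /D ler_pdivlMr ?subr_gt0//.
  have -> : 1 - eta = (eta^-1 - 1) * eta by rewrite mulrBl mulVf ?gt_eqF// mul1r.
  by rewrite mulrA ler_piMl// ltW.
pose rho := Num.max 2^-1 eta.
exists q, (2 * c ^+ 2 + 4 * q%:R * N * D + 4 * q%:R ^+ 2 * D ^+ 2), rho.
split => //.
- have := sqr_ge0 c; have := sqr_ge0 (q%:R * D); rewrite exprMn.
  have : 0 <= q%:R * N * D by rewrite -mulrA mulr_ge0 ?ler0n// mulr_ge0.
  nra.
- apply/andP; split; first by rewrite le_max invr_ge0 ler0n.
  by rewrite gt_max eta1 invf_lt1 ?ltr1n.
move=> k m bm.
have bk0 : 0 < beta ^+ k by rewrite exprn_gt0.
have m0 : 0 < m by exact: lt_le_trans bm.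
have sm0 : 0 < Num.sqrt m by rewrite sqrtr_gt0.
have smk : (Num.sqrt beta) ^+ k <= Num.sqrt m.
  rewrite -(ler_pXn2r (ltn0Sn 1)) ?nnegrE ?exprn_ge0 ?sqrtr_ge0//.
  by rewrite (sqr_sqrtr (ltW m0)) exprAC sb2.
have etarho : eta ^+ k <= rho ^+ k by rewrite lerXn2r ?nnegrE ?le_max ?lexx ?orbT// ltW.
have t1 : 2 * (c ^+ 2 * gam ^+ k * a ^+ (q * k)) / m ^+ 2 <= 2 * c ^+ 2 * rho ^+ k.
  have -> : 2 * (c ^+ 2 * gam ^+ k * a ^+ (q * k)) / m ^+ 2 =
      2 * c ^+ 2 * (gam ^+ k * a ^+ (q * k) / m ^+ 2) by rewrite !mulrA.
  have c2 : 0 <= 2 * c ^+ 2 by apply: mulr_ge0 => //; exact: sqr_ge0.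
  rewrite ler_wpM2l//.
  apply: (@le_trans _ _ ((gam / beta ^+ 2 * a ^+ q) ^+ k)).
    rewrite !exprMn -exprM mulrAC.
    rewrite ler_wpM2l//; first by apply: mulr_ge0; exact: exprn_ge0.
    rewrite exprVn lef_pV2 ?posrE ?exprn_gt0//.
    by rewrite exprAC ler_pXn2r ?nnegrE// ltW.
  rewrite lerXn2r ?nnegrE ?le_max ?invr_ge0 ?ler0n//.
    by rewrite mulr_ge0 ?exprn_ge0// divr_ge0 ?sqr_ge0.
  by rewrite (ltW qle).
have key : (2 ^ k)%:R^-1 / Num.sqrt m <= th ^+ k.
  rewrite /th exprVn exprMn invfM natrX ler_pM2l ?invr_gt0 ?exprn_gt0//.
  by rewrite lef_pV2 ?posrE ?exprn_gt0.
have E2 : 4 * (q * k)%:R * (N * Num.sqrt m) / ((2 ^ k)%:R * m) =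
    4 * q%:R * N * (k%:R * ((2 ^ k)%:R^-1 / Num.sqrt m)).
  rewrite -{2}(sqr_sqrtr (ltW m0)) natrM; field.
  by rewrite !gt_eqF// ltr0n expn_gt0.
have E3 : 4 * (q * k)%:R ^+ 2 / ((2 ^ k)%:R ^+ 2 * m) =
    4 * q%:R ^+ 2 * (k%:R * ((2 ^ k)%:R^-1 / Num.sqrt m)) ^+ 2.
  rewrite -{1}(sqr_sqrtr (ltW m0)) natrM; field.
  by rewrite !gt_eqF// ltr0n expn_gt0.
have t : k%:R * ((2 ^ k)%:R^-1 / Num.sqrt m) <= D * eta ^+ k.
  by apply: le_trans (kD k); rewrite ler_wpM2l.
rewrite E2 E3 2!(mulrDl _ _ (rho ^+ k)); apply: lerD; first apply: lerD => //.
- rewrite -[leRHS]mulrA ler_wpM2l ?mulr_ge0//.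
  by apply: (le_trans t); rewrite ler_wpM2l.
have q2 : 0 <= 4 * q%:R ^+ 2 :> R by apply: mulr_ge0 => //; exact: sqr_ge0.
rewrite -[leRHS]mulrA ler_wpM2l//.
have tge : 0 <= k%:R * ((2 ^ k)%:R^-1 / Num.sqrt m).
  by rewrite mulr_ge0// divr_ge0 ?invr_ge0// ltW.
apply: (@le_trans _ _ ((D * eta ^+ k) ^+ 2)).
  by rewrite ler_pXn2r ?nnegrE// (le_trans tge).
rewrite exprMn ler_wpM2l ?sqr_ge0//; apply: le_trans etarho.
by rewrite expr2 ler_piMl ?exprn_ge0 ?exprn_ile1 ?ltW.
Qed.

Lemma powR_expn (R : realType) (b t s : R) k :
  ((b `^ t) ^+ k) `^ s = (b `^ (t * s)) ^+ k.
Proof.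
rewrite -(powR_mulrn k (powR_ge0 b t)) -(powR_mulrn k (powR_ge0 b (t * s))).
by rewrite [LHS]powRAC powRrM.
Qed.

Lemma pow2N_lt1 (R : realType) (t : R) : 0 < t -> 2 `^ (- t) < 1 :> R.
Proof.
move=> t0; rewrite /powR pnatr_eq0/= expR_lt1 mulNr oppr_lt0.
by rewrite mulr_gt0// ln_gt0// ltr1n.
Qed.

Lemma eventually_dyadic_lt (R : realType) (t e : R) : 0 < t -> 0 < e ->
  \forall k \near \oo, 0 < (2 `^ (- t)) ^+ k < e.
Proof.
move=> t0 e0.
have cv : (2 `^ (- t)) ^+ k @[k --> \oo] --> (0 : R).
  by apply: cvg_expr; rewrite ger0_norm ?powR_ge0// pow2N_lt1.
have [k0 _ lt_e] := cvgr_lt _ cv _ e0; exists k0 => // k /lt_e /= ->.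
by rewrite exprn_gt0// powR_gt0.
Qed.

(** * The shortest distance between two orbits *)

Section shortest_orbit_distance.
Context {R : realType} {X : metricType R} {T : X -> X}.

Lemma shortest_orbit_distance_ltP n x y r : (0 < n)%N ->
  shortest_orbit_distance T n x y < r <->
  exists i j : 'I_n, ball (iter i T x) r (iter j T y).
Proof.
move=> n0; split.
  move/bigmin_ltP => [|[i _ /bigmin_ltP[|[j _]]]].
  - by move=> xy; exists (Ordinal n0), (Ordinal n0); rewrite ballEmdist.
  - by move=> xy; exists (Ordinal n0), (Ordinal n0); rewrite ballEmdist.
  - by move=> xy; exists i, j; rewrite ballEmdist.
move=> [i [j]]; rewrite ballEmdist => /= ij.
by apply/bigmin_ltP; right; exists i => //; apply/bigmin_ltP; right; exists j.
Qed.

(** The default value [mdist x y] of the minimum is what [n = 0] returns, so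
    monotonicity holds from there on. *)
Lemma shortest_orbit_distance_decreasing x y :
  {homo (fun n => shortest_orbit_distance T n x y) : m n / (m <= n)%N >-> n <= m}.
Proof.
move=> m n mn; rewrite leNgt; apply/negP.
case: n mn => [|n]; first by rewrite leqn0 => /eqP ->; rewrite ltxx.
move=> mn lt_mn.
suff /(shortest_orbit_distance_ltP _ _ _ _ (ltn0Sn n)) :
  exists i j : 'I_n.+1,
    ball (iter i T x) (shortest_orbit_distance T n.+1 x y) (iter j T y).
  by rewrite ltxx.
case: m mn lt_mn => [_|m mn].
  rewrite {1}/shortest_orbit_distance big_ord0 => xy.
  by exists ord0, ord0; rewrite ballEmdist.
move=> /(shortest_orbit_distance_ltP _ _ _ _ (ltn0Sn m))[i [j ij]].
by exists (widen_ord mn i), (widen_ord mn j).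
Qed.

End shortest_orbit_distance.

Lemma shortest_orbit_distance_ltE (d : measure_display) (R : realType)
    (X : measurableMetricType d R) (T : X -> X) (n : nat) (r : R) : (0 < n)%N ->
  [set z : X * X | shortest_orbit_distance T n z.1 z.2 < r] =
  \bigcup_(p : 'I_n * 'I_n) close_at (T := T) r p.1 p.2.
Proof.
move=> n0; apply/seteqP; split => z /=.
  by move=> /(shortest_orbit_distance_ltP _ _ _ _ n0)[i [j ij]]; exists (i, j).
by move=> [[i j] _ ij]; apply/(shortest_orbit_distance_ltP _ _ _ _ n0); exists i, j.
Qed.

(** * Almost sure bounds along powers of 2 *)

Section almost_sure_bounds.
Context {R : realType} {d : measure_display} {X : measurableMetricType d R}.
Context {mu : probability X R} {T : X -> X} {Cmu : R} {C : normedModType R}.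
Context {ev : C -> X -> R} {a r0 c xi : R}.
Hypothesis borelX : borel_sigma_algebra X.
Hypothesis mpT : measure_preserving mu T.
Hypothesis dimC : has_correlation_dimension mu Cmu.

Lemma measure_shortest_orbit_distance_lt n r : separable X -> (0 < n)%N ->
  ((mu \x mu) [set z | (shortest_orbit_distance T n z.1 z.2 < r)%R] <=
    (n%:R ^+ 2 * corr_integral mu r)%:E)%E.
Proof.
move=> sepX n0; rewrite shortest_orbit_distance_ltE//.
apply: (le_trans (measure_bigcup_fin_le _ _ _ _ _ _ _)) => [p|].
  exact: (measurable_close_at borelX sepX mpT).
rewrite (eq_bigr (fun=> (corr_integral mu r)%:E)); last first.
  by move=> p _; exact: (measure_close_at borelX sepX mpT).
by rewrite sumEFin sumr_const card_prod card_ord -[X in X%:E]mulr_natl natrM expr2.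
Qed.

(** Union bound. The midpoint [lo] of [2 / t] and [Cmu] is an exponent below
    [Cmu] that keeps the ratio [4 * 2 ^ (- t lo)] below 1. *)
Lemma ae_eventually_ge (t : R) : separable X -> 0 < t -> 2 < t * Cmu ->
  \forall z \ae (mu \x mu)%E, \forall k \near \oo,
    (2 `^ (- t)) ^+ k <= shortest_orbit_distance T (2 ^ k)%N z.1 z.2.
Proof.
move=> sepX t0 tC.
pose lo := (2 / t + Cmu) / 2.
have tlo : t * lo = (2 + t * Cmu) / 2 by rewrite /lo; field; rewrite gt_eqF.
have tl : 2 < t * lo by rewrite tlo; lra.
have lC : lo < Cmu by rewrite -(ltr_pM2l t0) tlo; lra.
have C1 : Cmu < Cmu + 1 by rewrite ltrDl.
have [r1 r10 bnd] := corr_integral_power_bounds sepX borelX dimC _ _ lC C1.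
have g1 : 4 * 2 `^ (- t * lo) < 1 :> R.
  rewrite (_ : 4 = 2 `^ 2) -?powRD; first last.
  - by rewrite powR_mulrn// -natrX.
  - by rewrite pnatr_eq0 implybT.
  by rewrite mulNr -opprB pow2N_lt1// subr_gt0.
have : \forall z \ae (mu \x mu)%E, \forall k \near \oo,
    ~ [set z : X * X |
        shortest_orbit_distance T (2 ^ k)%N z.1 z.2 < (2 `^ (- t)) ^+ k] z.
  apply: (borel_cantelli_geometric _ _ _ (mu \x mu)%E
    (fun k => [set z : X * X |
      shortest_orbit_distance T (2 ^ k)%N z.1 z.2 < (2 `^ (- t)) ^+ k])
    1 (4 * 2 `^ (- t * lo))) => //.
  - move=> k; rewrite shortest_orbit_distance_ltE ?expn_gt0//.
    apply: fin_bigcup_measurable => // p _.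
    exact: (measurable_close_at borelX sepX mpT).
  - by rewrite g1 mulr_ge0// powR_ge0.
  near=> k.
  apply: (le_trans (measure_shortest_orbit_distance_lt _ _ sepX _)).
    by rewrite expn_gt0.
  have bk : 0 < (2 `^ (- t)) ^+ k < r1 by near: k; exact: eventually_dyadic_lt.
  have /andP[_] := bnd _ bk; rewrite powR_expn => le_lo.
  rewrite lee_fin mul1r exprMn natrX -exprM mulnC exprM -natrX.
  by rewrite ler_wpM2l// exprn_ge0.
by apply: filterS => z; apply: filterS => k /negP; rewrite -leNgt.
Unshelve. all: end_near.
Qed.

Hypothesis a01 : 0 <= a < 1.
Hypothesis r001 : 0 < r0 < 1.
Hypothesis decay : exponential_decay mu T ev a.
Hypothesis massC : forall r : R, 0 < r < r0 ->
    in_with_norm_le ev (fun x => fine (mu (ball x r))) (c * r `^ (- xi)).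
Hypothesis ballC : \forall y \ae mu, forall r : R, 0 < r < r0 ->
    in_with_norm_le ev (\1_(ball y r)) (c * r `^ (- xi)).

(** Second moment bound. The midpoint [hi] of [2 / t] and [Cmu] is an exponent
    above [Cmu] for which [4 * beta], the growth ratio of the lower bound on
    the mean number of close pairs, still exceeds 1. *)
Lemma ae_eventually_lt (t : R) : tight X -> 0 < t -> t * Cmu < 2 ->
  \forall z \ae (mu \x mu)%E, \forall k \near \oo,
    shortest_orbit_distance T (2 ^ k)%N z.1 z.2 < (2 `^ (- t)) ^+ k.
Proof.
move=> tightX t0 tC; have [sepX _] := tightX.
pose hi := (2 / t + Cmu) / 2.
have thi : t * hi = (2 + t * Cmu) / 2 by rewrite /hi; field; rewrite gt_eqF.
have Ch : Cmu < hi by rewrite -(ltr_pM2l t0) thi; lra.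
have C1 : Cmu - 1 < Cmu by rewrite ltrBlDr ltrDl.
have [r1 r10 bnd] := corr_integral_power_bounds sepX borelX dimC _ _ C1 Ch.
have [r2 [N [r20 massS]]] := ball_mass_le_sqrt_corr_integral borelX mu tightX.
pose beta : R := 2 `^ (- t * hi).
have beta0 : 0 < beta by rewrite powR_gt0.
have b4 : 1 < 4 * beta.
  rewrite -[4 * beta]invrK invf_gt1; last by rewrite invr_gt0 mulr_gt0.
  have -> : (4 * beta)^-1 = 2 `^ (- (2 - t * hi)).
    rewrite /beta (_ : 4 = 2 `^ 2) -?powRD; first last.
    - by rewrite powR_mulrn// -natrX.
    - by rewrite pnatr_eq0 implybT.
    by rewrite mulNr powRN.
  by rewrite pow2N_lt1// subr_gt0 thi; lra.
have gam0 : 0 <= (2 `^ (- t * - xi)) ^+ 2 :> R by exact: sqr_ge0.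
have [q [L [rho [q0 L0 rho01 vb]]]] :=
  variance_bound_geometric _ a beta _ c N%:R a01 beta0 b4 gam0 (ler0n _ N).
have : \forall z \ae (mu \x mu)%E, \forall k \near \oo,
    ~ (\bigcap_(p : 'I_(2 ^ k) * 'I_(2 ^ k))
        ~` close_at (T := T) ((2 `^ (- t)) ^+ k) p.1 p.2) z.
  apply: (borel_cantelli_geometric _ _ _ (mu \x mu)%E
    (fun k => \bigcap_(p : 'I_(2 ^ k) * 'I_(2 ^ k))
      ~` close_at (T := T) ((2 `^ (- t)) ^+ k) p.1 p.2) L rho) => //.
  - move=> k; apply: fin_bigcap_measurable => // p _; apply: measurableC.
    exact: (measurable_close_at borelX sepX mpT).
  near=> k.
  have k0 : (0 < k)%N by near: k; exists 1%N.
  have rr1 : 0 < (2 `^ (- t)) ^+ k < r1 by near: k; exact: eventually_dyadic_lt.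
  have rr2 : 0 < (2 `^ (- t)) ^+ k < r2 by near: k; exact: eventually_dyadic_lt.
  have rr0 : 0 < (2 `^ (- t)) ^+ k < r0.
    by near: k; apply: eventually_dyadic_lt => //; case/andP: r001.
  set r := (2 `^ (- t)) ^+ k in rr0 rr1 rr2 *.
  have /andP[le_hi _] := bnd _ rr1; rewrite powR_expn -/beta in le_hi.
  have M0 : 0 < corr_integral mu r by apply: lt_le_trans le_hi; rewrite exprn_gt0.
  have ballr : \forall y \ae mu, in_with_norm_le ev (\1_(ball y r)) (c * r `^ (- xi)).
    by move: ballC; apply: filterS => y; apply.
  apply: (le_trans (measure_never_close_le borelX sepX mpT r decay a01
    (massC _ rr0) ballr (q * k)%N _ _ (fun x => massS r x rr2) (2 ^ k)%N _ M0)).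
  - by rewrite muln_gt0 q0.
  - by rewrite expn_gt0.
  rewrite lee_fin; apply: le_trans (vb k _ le_hi).
  have -> : (c * r `^ (- xi)) ^+ 2 = c ^+ 2 * ((2 `^ (- t * - xi)) ^+ 2) ^+ k.
    by rewrite exprMn powR_expn exprAC.
  by [].
apply: filterS => z; apply: filterS => k H.
suff : [set z : X * X |
    shortest_orbit_distance T (2 ^ k)%N z.1 z.2 < (2 `^ (- t)) ^+ k] z by [].
rewrite shortest_orbit_distance_ltE ?expn_gt0//.
apply: contrapT => H2; apply: H => p _ zp; by apply: H2; exists p.
Unshelve. all: end_near.
Qed.
End almost_sure_bounds.

Theorem theorem3 (R : realType) (d : measure_display)
  (X : measurableMetricType d R) (mu : probability X R) (T : X -> X)
  (Cmu : R) (C : completeNormedModType R) (ev : C -> X -> R)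
  (a r0 c xi : R) :
  borel_sigma_algebra X ->
  finite_dimensional X ->
  measure_preserving mu T ->
  tight X ->
  has_correlation_dimension mu Cmu ->
  0 < Cmu ->
  is_function_space ev ->
  0 <= a < 1 ->
  0 < r0 < 1 ->
  0 <= c ->
  0 <= xi ->
  exponential_decay mu T ev a ->
  (forall r : R, 0 < r < r0 ->
    in_with_norm_le ev (fun x => fine (mu (ball x r))) (c * r `^ (- xi))) ->
  (\forall y \ae mu, forall r : R, 0 < r < r0 ->
    in_with_norm_le ev (\1_(ball y r)) (c * r `^ (- xi))) ->
  \forall z \ae (mu \x mu)%E,
    (lne (shortest_orbit_distance T n z.1 z.2)%:E / (- ln n%:R)%:E)%E
      @[n --> \oo] --> (2 / Cmu)%:E.
Proof.
move=> borelX _ mpT tightX dimC C0 _ a01 r001 _ _ decay massC ballC.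
have [sepX _] := tightX.
have L0 : 0 < 2 / Cmu by rewrite divr_gt0.
have LC : 2 / Cmu * Cmu = 2 by rewrite divfK// gt_eqF.
have m0 m : 0 < m.+2%:R^-1 :> R by rewrite invr_gt0.
have m1 m : m.+2%:R^-1 < 1 :> R by rewrite invf_lt1 ?ltr1n.
have lt_ae : \forall z \ae (mu \x mu)%E, forall m : nat, \forall k \near \oo,
    shortest_orbit_distance T (2 ^ k)%N z.1 z.2 <
      (2 `^ (- (2 / Cmu * (1 - m.+2%:R^-1)))) ^+ k.
  apply: ae_foralln => m.
  apply: (ae_eventually_lt borelX mpT dimC a01 r001 decay massC ballC _ tightX).
    by rewrite mulr_gt0// subr_gt0.
  by rewrite mulrAC LC; move: (m0 m); move: (m.+2%:R^-1) => x; lra.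
have ge_ae : \forall z \ae (mu \x mu)%E, forall m : nat, \forall k \near \oo,
    (2 `^ (- (2 / Cmu * (1 + m.+2%:R^-1)))) ^+ k <=
      shortest_orbit_distance T (2 ^ k)%N z.1 z.2.
  apply: ae_foralln => m.
  apply: (ae_eventually_ge borelX mpT dimC _ sepX).
    by rewrite mulr_gt0// addr_gt0.
  by rewrite mulrAC LC; move: (m0 m); move: (m.+2%:R^-1) => x; lra.
move: lt_ae ge_ae; apply: filterS2 => z lt_z ge_z.
apply: (cvg_log_ratio_of_dyadic _ (fun n => shortest_orbit_distance T n z.1 z.2)) => //.
exact: shortest_orbit_distance_decreasing.
Qed.
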